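(* Let $k$ be a field, $A$ a $k$-algebra, $p(x)=x^2-\alpha x+\beta\in k[x]$, $B=k[x]/(p(x))$, and let $A\otimes_{(f,\delta)}B$ be the twisted tensor product given by the pair $(f,\delta)$. An algebra endomorphism $\varphi:A\to A$ can be lifted to an algebra endomorphism of $A\otimes_{(f,\delta)}B$ (that is, the linear map $\tilde\varphi(a\otimes b):=\varphi(a)\otimes b$ is an algebra endomorphism of $A\otimes_{(f,\delta)}B$) if, and only if, $$f\varphi=\varphi f\quad\text{and}\quad \delta\varphi=\varphi\delta .$$
   Context: All algebras are unital associative $k$-algebras, algebra morphisms are unital, all maps are $k$-linear, $\otimes=\otimes_k$. For algebras $A,B$ a twisting map is a linear map $\tau:B\otimes A\to A\otimes B$ with $\tau\circ(B\otimes\mu_A)=(\mu_A\otimes B)\circ(A\otimes\tau)\circ(\tau\otimes A)$, $\tau\circ(\mu_B\otimes A)=(A\otimes\mu_B)\circ(\tau\otimes B)\circ(B\otimes\tau)$, $\tau(1\otimes a)=a\otimes1$, $\tau(b\otimes1)=1\otimes b$. The twisted tensor product $A\otimes_\tau B$ is the vector space $A\otimes B$ with the associative product $(\mu_A\otimes\mu_B)\circ(A\otimes\tau\otimes B)$. For $B=k[x]/(p(x))$ with $p(x)=x^2-\alpha x+\beta$, twisting maps $\tau:B\otimes A\to A\otimes B$ correspond to pairs $(f,\delta)$ with $f:A\to A$ an algebra endomorphism, $\delta:A\to A$ a left $f$-derivation ($\delta(ab)=\delta(a)b+f(a)\delta(b)$), $\delta^2-\alpha\delta+\beta\,\mathrm{id}_A=\beta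 f^2$ and $f\delta+\delta f=\alpha(f-f^2)$, via $\tau(x\otimes a)=\delta(a)\otimes1+f(a)\otimes x$; then $A\otimes_{(f,\delta)}B:=A\otimes_\tau B$. *)

(* Defs.v *)
From HB Require Import structures.
From mathcomp Require Import all_boot all_algebra.
From mathcomp Require Import boolp.

Set Implicit Arguments.
Unset Strict Implicit.
Unset Printing Implicit Defensive.

Import GRing.Theory.
Local Open Scope ring_scope.
Local Open Scope quotient_scope.

Reserved Notation "v \ox w" (at level 40, left associativity).

Section Tensor.
Variables (k : fieldType) (V W : lmodType k).

(* [tensor V W] is the set of formal finite sums of pairs (v, w), modulo the
   congruence generated by the bilinearity relations. *)
Inductive tensor_rel : seq (V * W) -> seq (V * W) -> Prop :=
| tensor_rel_refl s : tensor_rel s s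
| tensor_rel_sym s t : tensor_rel s t -> tensor_rel t s
| tensor_rel_trans s t u :
    tensor_rel s t -> tensor_rel t u -> tensor_rel s u
| tensor_rel_cat s1 s2 t1 t2 :
    tensor_rel s1 t1 -> tensor_rel s2 t2 -> tensor_rel (s1 ++ s2) (t1 ++ t2)
| tensor_rel_comm s t : tensor_rel (s ++ t) (t ++ s)
| tensor_rel_zero w : tensor_rel [:: (0, w)] [::]
| tensor_rel_addl v v' w :
    tensor_rel [:: (v + v', w)] [:: (v, w); (v', w)]
| tensor_rel_addr v w w' :
    tensor_rel [:: (v, w + w')] [:: (v, w); (v, w')]
| tensor_rel_scale c v w : tensor_rel [:: (c *: v, w)] [:: (v, c *: w)].

Definition tensor_relb : rel (seq (V * W)) := fun s t => `[< tensor_rel s t >].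

Lemma tensor_relb_refl : reflexive tensor_relb.
Proof. by move=> s; apply/asboolP; exact: tensor_rel_refl. Qed.

Lemma tensor_relb_sym : symmetric tensor_relb.
Proof.
by move=> s t; apply/asboolP/asboolP => /tensor_rel_sym.
Qed.

Lemma tensor_relb_trans : transitive tensor_relb.
Proof.
move=> t s u /asboolP st /asboolP tu.
by apply/asboolP; exact: tensor_rel_trans st tu.
Qed.

Canonical tensor_equiv :=
  EquivRel tensor_relb tensor_relb_refl tensor_relb_sym tensor_relb_trans.

Definition tensor := {eq_quot tensor_equiv}.

HB.instance Definition _ := Choice.on tensor.
HB.instance Definition _ := EqQuotient.on tensor.

Lemma tensor_quotW (P : tensor -> Prop) :
  (forall s, P (\pi_tensor s)) -> forall x, P x.
Proof. by move=> Ppi x; rewrite -[x]reprK; exact: Ppi. Qed.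

Lemma tensor_piP s t : reflect (tensor_rel s t) (\pi_tensor s == \pi_tensor t).
Proof. by rewrite eqmodE; exact: asboolP. Qed.

Lemma tensor_pi_eq s t : tensor_rel s t -> \pi_tensor s = \pi_tensor t.
Proof. by move/tensor_piP/eqP. Qed.

Lemma tensor_repr_pi s : tensor_rel (repr (\pi_tensor s)) s.
Proof. by apply/tensor_piP; rewrite reprK. Qed.

Definition tensor_add (x y : tensor) : tensor := \pi_tensor (repr x ++ repr y).
Definition tensor_zero : tensor := \pi_tensor [::].
Definition tensor_scale (c : k) (x : tensor) : tensor :=
  \pi_tensor [seq (c *: p.1, p.2) | p <- repr x].

Lemma tensor_add_pi s t :
  tensor_add (\pi_tensor s) (\pi_tensor t) = \pi_tensor (s ++ t).
Proof.
by apply: tensor_pi_eq; apply: tensor_rel_cat; exact: tensor_repr_pi.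
Qed.

Lemma tensor_rel_map c s t : tensor_rel s t ->
  tensor_rel [seq (c *: p.1, p.2) | p <- s] [seq (c *: p.1, p.2) | p <- t].
Proof.
elim=> {s t}.
- by move=> s; exact: tensor_rel_refl.
- by move=> s t _; exact: tensor_rel_sym.
- by move=> s t u _ st _; exact: tensor_rel_trans st.
- move=> s1 s2 t1 t2 _ h1 _ h2; rewrite !map_cat; exact: tensor_rel_cat.
- move=> s t; rewrite !map_cat; exact: tensor_rel_comm.
- by move=> w /=; rewrite scaler0; exact: tensor_rel_zero.
- by move=> v v' w /=; rewrite scalerDr; exact: tensor_rel_addl.
- by move=> v w w' /=; exact: tensor_rel_addr.
- move=> d v w /=; rewrite scalerA mulrC -scalerA; exact: tensor_rel_scale.
Qed.

Lemma tensor_scale_pi c s :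
  tensor_scale c (\pi_tensor s) = \pi_tensor [seq (c *: p.1, p.2) | p <- s].
Proof. by apply/tensor_pi_eq/tensor_rel_map/tensor_repr_pi. Qed.

Lemma tensor_addA : associative tensor_add.
Proof.
by elim/tensor_quotW=> s; elim/tensor_quotW=> t; elim/tensor_quotW=> u; rewrite !tensor_add_pi catA.
Qed.

Lemma tensor_addC : commutative tensor_add.
Proof.
elim/tensor_quotW=> s; elim/tensor_quotW=> t; rewrite !tensor_add_pi.
by apply: tensor_pi_eq; exact: tensor_rel_comm.
Qed.

Lemma tensor_add0 : left_id tensor_zero tensor_add.
Proof. by elim/tensor_quotW=> s; rewrite tensor_add_pi. Qed.

Lemma tensor_scale_addr c : {morph tensor_scale c : x y / tensor_add x y}.
Proof.
by elim/tensor_quotW=> s; elim/tensor_quotW=> t; rewrite tensor_add_pi !tensor_scale_pi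
  tensor_add_pi map_cat.
Qed.

Lemma tensor_scale_addl c d x :
  tensor_scale (c + d) x = tensor_add (tensor_scale c x) (tensor_scale d x).
Proof.
elim/tensor_quotW: x => s; rewrite !tensor_scale_pi tensor_add_pi.
apply: tensor_pi_eq; elim: s => [|[v w] s IHs]; first exact: tensor_rel_refl.
rewrite /= -cat1s -[X in tensor_rel _ X]/(
  [:: (c *: v, w)] ++ ([seq (c *: p.1, p.2) | p <- s] ++
  ([:: (d *: v, w)] ++ [seq (d *: p.1, p.2) | p <- s]))).
apply: (@tensor_rel_trans _
  ([:: (c *: v, w); (d *: v, w)] ++ ([seq (c *: p.1, p.2) | p <- s] ++
   [seq (d *: p.1, p.2) | p <- s]))).
  apply: tensor_rel_cat; last exact: IHs.
  by rewrite scalerDl; exact: tensor_rel_addl.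
rewrite -[[:: (c *: v, w); _]]/([:: (c *: v, w)] ++ [:: (d *: v, w)]) -catA.
apply: tensor_rel_cat; first exact: tensor_rel_refl.
rewrite !catA; apply: tensor_rel_cat; last exact: tensor_rel_refl.
exact: tensor_rel_comm.
Qed.

Lemma tensor_scale1 : left_id 1 tensor_scale.
Proof.
elim/tensor_quotW=> s; rewrite tensor_scale_pi; congr (\pi _).
by rewrite -[RHS]map_id; apply: eq_map => -[v w] /=; rewrite scale1r.
Qed.

Lemma tensor_scaleA c d x :
  tensor_scale c (tensor_scale d x) = tensor_scale (c * d) x.
Proof.
elim/tensor_quotW: x => s; rewrite !tensor_scale_pi -map_comp; congr (\pi _).
by apply: eq_map => -[v w] /=; rewrite scalerA.
Qed.

Lemma tensor_scale0 x : tensor_scale 0 x = tensor_zero.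
Proof.
elim/tensor_quotW: x => s; rewrite tensor_scale_pi; apply: tensor_pi_eq.
elim: s => [|[v w] s IHs] /=; first exact: tensor_rel_refl.
rewrite scale0r -cat1s -[X in tensor_rel _ X]cats0.
by apply: tensor_rel_cat => //; exact: tensor_rel_zero.
Qed.

Lemma tensor_addN :
  left_inverse tensor_zero (tensor_scale (-1)) tensor_add.
Proof.
move=> x; rewrite -{2}[x]tensor_scale1 -tensor_scale_addl addNr.
exact: tensor_scale0.
Qed.

HB.instance Definition _ := GRing.isZmodule.Build tensor
  tensor_addA tensor_addC tensor_add0 tensor_addN.

HB.instance Definition _ := GRing.Zmodule_isLmodule.Build k tensor
  tensor_scaleA tensor_scale1 tensor_scale_addr
  (fun x c d => tensor_scale_addl c d x).

Definition tens (v : V) (w : W) : tensor := \pi_tensor [:: (v, w)].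

Lemma tens_is_bilinear : bilinear_for *:%R *:%R tens.
Proof.
have Zl c v w : tens (c *: v) w = c *: tens v w.
  by rewrite /tens [RHS]tensor_scale_pi.
have Zr c v w : tens v (c *: w) = c *: tens v w.
  by rewrite -Zl; apply/esym/tensor_pi_eq; exact: tensor_rel_scale.
split=> [w c v v'|v c w w'] /=.
- rewrite -Zl /tens [RHS]tensor_add_pi.
  by apply: tensor_pi_eq; exact: tensor_rel_addl.
- rewrite -Zr /tens [RHS]tensor_add_pi.
  by apply: tensor_pi_eq; exact: tensor_rel_addr.
Qed.

HB.instance Definition _ :=
  bilinear_isBilinear.Build k V W tensor *:%R *:%R tens tens_is_bilinear.

Lemma tensor_pi_cons v w s :
  \pi_tensor ((v, w) :: s) = tens v w + \pi_tensor s.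
Proof. by rewrite [RHS]tensor_add_pi. Qed.

Lemma tensor_ind (P : tensor -> Prop) : (forall v w, P (tens v w)) ->
  (forall x y, P x -> P y -> P (x + y)) -> forall x, P x.
Proof.
move=> Ptens PD; elim/tensor_quotW; elim=> [|[v w] s IHs].
  by have := Ptens 0 0; rewrite linear0l.
by rewrite tensor_pi_cons; apply: PD.
Qed.

Lemma tensor_pi_sum s : \pi_tensor s = \sum_(p <- s) tens p.1 p.2.
Proof.
elim: s => [|[v w] s IHs]; first by rewrite big_nil.
by rewrite big_cons -IHs tensor_pi_cons.
Qed.

Lemma tensor_sum (x : tensor) : x = \sum_(p <- repr x) tens p.1 p.2.
Proof. by rewrite -tensor_pi_sum reprK. Qed.

End Tensor.

Notation "v \ox w" := (tens v w) : ring_scope.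

HB.lock Definition tensor_lift (k : fieldType) (V W U : lmodType k)
    (h : V -> W -> U) (x : tensor V W) : U :=
  \sum_(p <- repr x) h p.1 p.2.
Canonical tensor_lift_unlockable := Unlockable tensor_lift.unlock.

Section Lift.
Variables (k : fieldType) (V W U : lmodType k).
Local Notation tensor := (tensor V W).
Variable h : {bilinear V -> W -> U}.

Lemma tensor_rel_lift s t : tensor_rel s t ->
  \sum_(p <- s) h p.1 p.2 = \sum_(p <- t) h p.1 p.2.
Proof.
elim=> {s t} //.
- by move=> s t u _ -> _ ->.
- by move=> s1 s2 t1 t2 _ h1 _ h2; rewrite !big_cat /= h1 h2.
- by move=> s t; rewrite !big_cat /= addrC.
- by move=> w; rewrite big_seq1 big_nil /= linear0l.
- by move=> v v' w; rewrite big_seq1 !big_cons big_nil /= addr0 linearDl.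
- by move=> v w w'; rewrite big_seq1 !big_cons big_nil /= addr0 linearDr.
- by move=> c v w; rewrite !big_seq1 /= linearZl_LR linearZr_LR.
Qed.

Lemma tensor_lift_pi s :
  tensor_lift h (\pi_tensor s) = \sum_(p <- s) h p.1 p.2.
Proof. by rewrite unlock; apply: tensor_rel_lift; exact: tensor_repr_pi. Qed.

Lemma tensor_liftE v w : tensor_lift h (tens v w) = h v w.
Proof. by rewrite tensor_lift_pi big_seq1. Qed.

Lemma tensor_lift_is_linear : linear (tensor_lift h).
Proof.
move=> c; elim/tensor_quotW=> s; elim/tensor_quotW=> t.
rewrite [c *: _]tensor_scale_pi [_ + _]tensor_add_pi !tensor_lift_pi big_cat.
congr (_ + _); rewrite big_map scaler_sumr.
by apply: eq_bigr => p _ /=; rewrite /= linearZl_LR.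
Qed.

HB.instance Definition _ := GRing.isLinear.Build k tensor U *:%R
  (tensor_lift h) tensor_lift_is_linear.

End Lift.

Section TensorMaps.
Variable k : fieldType.
Implicit Types U V W : lmodType k.

Lemma eq_tensor_lin U V W (g h : {linear tensor V W -> U}) :
  (forall v w, g (v \ox w) = h (v \ox w)) -> g =1 h.
Proof.
move=> gh x; rewrite [x]tensor_sum !linear_sum.
by apply: eq_bigr => p _ /=; exact: gh.
Qed.

Definition tmap_pure V W V' W' (g : V -> V') (h : W -> W') v w : tensor V' W' :=
  g v \ox h w.

Lemma tmap_pure_is_bilinear V W V' W' (g : {linear V -> V'})
    (h : {linear W -> W'}) : bilinear_for *:%R *:%R (tmap_pure g h).
Proof.
by split=> [w|v] c u u' /=; rewrite /tmap_pure linearP ?linearPl ?linearPr.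
Qed.

HB.instance Definition _ V W V' W' (g : {linear V -> V'})
    (h : {linear W -> W'}) :=
  bilinear_isBilinear.Build k V W (tensor V' W') *:%R *:%R (tmap_pure g h)
    (tmap_pure_is_bilinear g h).

Definition tmap V W V' W' (g : V -> V') (h : W -> W') :
    tensor V W -> tensor V' W' :=
  tensor_lift (tmap_pure g h).

HB.instance Definition _ V W V' W' (g : {linear V -> V'})
    (h : {linear W -> W'}) := GRing.Linear.on (tmap g h).

Lemma tmapE V W V' W' (g : {linear V -> V'}) (h : {linear W -> W'}) v w :
  tmap g h (v \ox w) = g v \ox h w.
Proof. exact: (tensor_liftE (tmap_pure g h)). Qed.

Section Associator.
Variables U V W : lmodType k.

Definition tassoc_pure2 w (u : U) (v : V) : tensor U (tensor V W) :=
  u \ox (v \ox w).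

Lemma tassoc_pure2_is_bilinear w : bilinear_for *:%R *:%R (tassoc_pure2 w).
Proof.
by split=> [v|u] c y z /=; rewrite /tassoc_pure2 ?linearPl ?linearPr.
Qed.

HB.instance Definition _ w :=
  bilinear_isBilinear.Build k U V (tensor U (tensor V W)) *:%R *:%R
    (tassoc_pure2 w) (tassoc_pure2_is_bilinear w).

Definition tassoc_pure (x : tensor U V) w := tensor_lift (tassoc_pure2 w) x.

Lemma tassoc_pure_is_bilinear : bilinear_for *:%R *:%R tassoc_pure.
Proof.
split=> [w|x] c y z /=; rewrite /tassoc_pure ?linearP//.
rewrite unlock scaler_sumr -big_split; apply: eq_bigr => p _ /=.
by rewrite /tassoc_pure2 !linearPr.
Qed.

HB.instance Definition _ :=
  bilinear_isBilinear.Build k (tensor U V) W (tensor U (tensor V W))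
    *:%R *:%R tassoc_pure tassoc_pure_is_bilinear.

Definition tassoc : tensor (tensor U V) W -> tensor U (tensor V W) :=
  tensor_lift tassoc_pure.

HB.instance Definition _ := GRing.Linear.on tassoc.

Lemma tassocE u v w : tassoc ((u \ox v) \ox w) = u \ox (v \ox w).
Proof.
by rewrite /tassoc tensor_liftE /tassoc_pure; exact: tensor_liftE.
Qed.

Definition tassocV_pure2 (u : U) v w : tensor (tensor U V) W :=
  (u \ox v) \ox w.

Lemma tassocV_pure2_is_bilinear u : bilinear_for *:%R *:%R (tassocV_pure2 u).
Proof.
by split=> [w|v] c y z /=; rewrite /tassocV_pure2 ?linearPr ?linearPl.
Qed.

HB.instance Definition _ u :=
  bilinear_isBilinear.Build k V W (tensor (tensor U V) W) *:%R *:%R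
    (tassocV_pure2 u) (tassocV_pure2_is_bilinear u).

Definition tassocV_pure u (x : tensor V W) := tensor_lift (tassocV_pure2 u) x.

Lemma tassocV_pure_is_bilinear : bilinear_for *:%R *:%R tassocV_pure.
Proof.
split=> [x|u] c y z /=; rewrite /tassocV_pure ?linearP//.
rewrite unlock scaler_sumr -big_split; apply: eq_bigr => p _ /=.
by rewrite /tassocV_pure2 !linearPl.
Qed.

HB.instance Definition _ :=
  bilinear_isBilinear.Build k U (tensor V W) (tensor (tensor U V) W)
    *:%R *:%R tassocV_pure tassocV_pure_is_bilinear.

Definition tassocV : tensor U (tensor V W) -> tensor (tensor U V) W :=
  tensor_lift tassocV_pure.

HB.instance Definition _ := GRing.Linear.on tassocV.

Lemma tassocVE u v w : tassocV (u \ox (v \ox w)) = (u \ox v) \ox w.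
Proof.
by rewrite /tassocV tensor_liftE /tassocV_pure; exact: tensor_liftE.
Qed.

End Associator.

Section Multiplication.
Variable A : algType k.

Definition tmul_pure (a b : A) : A := a * b.

Lemma tmul_pure_is_bilinear : bilinear_for *:%R *:%R tmul_pure.
Proof.
split=> [b|a] c x y /=; rewrite /tmul_pure.
- by rewrite mulrDl scalerAl.
- by rewrite mulrDr scalerAr.
Qed.

HB.instance Definition _ :=
  bilinear_isBilinear.Build k A A A *:%R *:%R tmul_pure tmul_pure_is_bilinear.

Definition tmul : tensor A A -> A := tensor_lift tmul_pure.

HB.instance Definition _ := GRing.Linear.on tmul.

Lemma tmulE a b : tmul (a \ox b) = a * b.
Proof. exact: tensor_liftE. Qed.

End Multiplication.

End TensorMaps.
Arguments tmul {k} A.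

Section Twisting.
Variables (k : fieldType) (A B : algType k).

Record twisting_map (tau : tensor B A -> tensor A B) : Prop := TwistingMap {
  twisting_mulA : forall b a a',
    tau (tmap idfun (tmul A) (b \ox (a \ox a'))) =
    tmap (tmul A) idfun
      (tassocV (tmap idfun tau (tassoc (tmap tau idfun ((b \ox a) \ox a')))));
  twisting_mulB : forall b b' a,
    tau (tmap (tmul B) idfun ((b \ox b') \ox a)) =
    tmap idfun (tmul B)
      (tassoc (tmap tau idfun (tassocV (tmap idfun tau (b \ox (b' \ox a))))));
  twisting_1A : forall a, tau (1 \ox a) = a \ox 1;
  twisting_1B : forall b, tau (b \ox 1) = 1 \ox b
}.

Record twisting := Twisting {
  twist :> {linear tensor B A -> tensor A B};
  twistP : twisting_map twist
}.

Definition twisted_tensor of twisting := tensor A B.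

End Twisting.

Section TwistedTensor.
Variables (k : fieldType) (A B : algType k) (tau : twisting A B).
Local Notation T := (twisted_tensor tau).
Implicit Types (a : A) (b : B).

HB.instance Definition _ := GRing.Lmodule.on T.

(* (mu_A (x) mu_B) o (A (x) tau (x) B), with the associators made explicit. *)
Definition twisted_mul (x y : T) : T :=
  tmap (tmul A) (tmul B) (tassocV (tmap idfun (@tassoc k A B B)
    (tmap idfun (tmap tau idfun)
      (tmap idfun (@tassocV k B A B) (tassoc (x \ox y)))))).

Definition twisted_one : T := 1 \ox 1.

Lemma twisted_mul_is_bilinear : bilinear_for *:%R *:%R twisted_mul.
Proof.
split=> [y|x] c u v /=; rewrite /twisted_mul.
- by rewrite (linearPl (@tens k (tensor A B) (tensor A B))) !linearP.
- by rewrite (linearPr (@tens k (tensor A B) (tensor A B))) !linearP.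
Qed.

HB.instance Definition _ := bilinear_isBilinear.Build k T T T *:%R *:%R
  twisted_mul twisted_mul_is_bilinear.


Definition tact a b : tensor A B -> tensor A B :=
  tmap (GRing.mull_fun a idfun) (GRing.mulr_fun b idfun).

HB.instance Definition _ a b := GRing.Linear.on (tact a b).

Lemma tactE a b a' b' : tact a b (a' \ox b') = (a * a') \ox (b' * b).
Proof. exact: tmapE. Qed.

Lemma tact_comp a b a' b' x :
  tact a b (tact a' b' x) = tact (a * a') (b' * b) x.
Proof.
rewrite [x]tensor_sum !linear_sum; apply: eq_bigr => p _ /=.
by rewrite !tactE !mulrA.
Qed.

Lemma twisted_mulE a b a' b' :
  twisted_mul (a \ox b) (a' \ox b') = tact a b' (tau (b \ox a')).
Proof.
rewrite /twisted_mul tassocE tmapE /= tassocVE tmapE /= tmapE /= tmapE /=.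
rewrite [tau _]tensor_sum !(linear_sum, linear_sumlz, linear_sumr) /=.
apply: eq_bigr => p _ /=.
by rewrite tassocE tassocVE tmapE /= !tmulE tactE.
Qed.

Lemma twist_mulA b a a' :
  tau (b \ox (a * a')) =
  \sum_(p <- repr (tau (b \ox a))) tact p.1 1 (tau (p.2 \ox a')).
Proof.
have := twisting_mulA (twistP tau) b a a'; rewrite tmapE /= tmulE => -> /=.
rewrite tmapE /=.
rewrite {1}[tau (b \ox a)]tensor_sum !(linear_sum, linear_sumlz) /=.
apply: eq_bigr => p _ /=; rewrite tassocE tmapE /=.
rewrite [tau _]tensor_sum !(linear_sum, linear_sumr) /=.
apply: eq_bigr => q _ /=.
by rewrite tassocVE tmapE /= tmulE tactE mulr1.
Qed.

Lemma twist_mulB b b' a :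
  tau ((b * b') \ox a) =
  \sum_(p <- repr (tau (b' \ox a))) tact 1 p.2 (tau (b \ox p.1)).
Proof.
have := twisting_mulB (twistP tau) b b' a; rewrite tmapE /= tmulE => -> /=.
rewrite tmapE /=.
rewrite {1}[tau (b' \ox a)]tensor_sum !(linear_sum, linear_sumr) /=.
apply: eq_bigr => p _ /=; rewrite tassocVE tmapE /=.
rewrite [tau _]tensor_sum !(linear_sum, linear_sumlz) /=.
apply: eq_bigr => q _ /=.
by rewrite tassocE tmapE /= tmulE tactE mul1r.
Qed.

Lemma twisted_mulA : associative twisted_mul.
Proof.
move=> x y z.
elim/tensor_ind: x => [a b|x x' IHx IHx']; last by rewrite !linearDl /= IHx IHx'.
elim/tensor_ind: y => [a' b'|y y' IHy IHy'];
  last by rewrite !(linearDl, linearDr) /= IHy IHy'.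
elim/tensor_ind: z => [a'' b''|z z' IHz IHz']; last by rewrite !linearDr /= IHz IHz'.
rewrite !twisted_mulE.
have -> : twisted_mul (a \ox b) (tact a' b'' (tau (b' \ox a''))) =
  \sum_(q <- repr (tau (b' \ox a''))) \sum_(p <- repr (tau (b \ox a')))
    tact (a * p.1) (q.2 * b'') (tau (p.2 \ox q.1)).
  rewrite [X in tact a' b'' X]tensor_sum !(linear_sum, linear_sumr).
  apply: eq_bigr => q _ /=; rewrite tactE twisted_mulE twist_mulA linear_sum.
  by apply: eq_bigr => p _ /=; rewrite tact_comp mul1r.
rewrite exchange_big /= [X in tact a b' X]tensor_sum !(linear_sum, linear_sumlz).
apply: eq_bigr => p _ /=; rewrite tactE twisted_mulE twist_mulB linear_sum.
by apply: eq_bigr => q _ /=; rewrite tact_comp mulr1.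
Qed.

Lemma twisted_mul1x : left_id twisted_one twisted_mul.
Proof.
move=> x; rewrite [x]tensor_sum linear_sumr; apply: eq_bigr => p _ /=.
by rewrite twisted_mulE (twisting_1A (twistP tau)) tactE !mul1r.
Qed.

Lemma twisted_mulx1 : right_id twisted_one twisted_mul.
Proof.
move=> x; rewrite [x]tensor_sum linear_sumlz; apply: eq_bigr => p _ /=.
by rewrite twisted_mulE (twisting_1B (twistP tau)) tactE !mulr1.
Qed.

Lemma twisted_mulDl : left_distributive twisted_mul +%R.
Proof. by move=> x y z; rewrite linearDl. Qed.

Lemma twisted_mulDr : right_distributive twisted_mul +%R.
Proof. by move=> x y z; rewrite linearDr. Qed.

HB.instance Definition _ := GRing.Zmodule_isPzRing.Build T
  twisted_mulA twisted_mul1x twisted_mulx1 twisted_mulDl twisted_mulDr.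

End TwistedTensor.

Section QuadraticTwist.
Variables (k : fieldType) (alpha beta : k).

Definition quad_poly : {poly k} := 'X^2 - alpha *: 'X + beta%:P.

Local Notation B := {poly %/ quad_poly}.

Lemma size_quad_poly : size quad_poly = 3%N.
Proof.
rewrite /quad_poly -addrA size_polyDl size_polyXn//.
apply: leq_ltn_trans (size_polyD _ _) _; rewrite gtn_max size_polyN.
rewrite (leq_ltn_trans (size_scale_leq _ _)) ?size_polyX//.
by rewrite (leq_ltn_trans (size_polyC_leq1 _)).
Qed.

Lemma quad_poly_monic : quad_poly \is monic.
Proof.
rewrite monicE lead_coefE size_quad_poly /quad_poly.
by rewrite !coefE /= mulr0 subr0 addr0.
Qed.

(* {poly %/ p} is the quotient by mk_monic p, which differs from p in general. *)
Lemma mk_monic_quad_poly : mk_monic quad_poly = quad_poly.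
Proof. by rewrite /mk_monic size_quad_poly quad_poly_monic. Qed.

Lemma quadX_val : ('qX : B) = 'X :> {poly k}.
Proof. by rewrite qpolyXE ?size_quad_poly// quad_poly_monic. Qed.

Lemma quad_basis (b : B) : b = (b : {poly k})`_0 *: 1 + (b : {poly k})`_1 *: 'qX.
Proof.
apply: val_inj.
rewrite [RHS](_ : _ = (b : {poly k})`_0 *: 1 + (b : {poly k})`_1 *: 'X); last first.
  by rewrite -quadX_val.
have sb : (size (b : {poly k}) <= 2)%N.
  rewrite -ltnS -size_quad_poly.
  by apply: leq_trans (size_mk_monic b) _; rewrite mk_monic_quad_poly.
apply/polyP => -[|[|i]]; rewrite !coefE /=; rewrite ?mulr0 ?mulr1 ?addr0 ?add0r//.
by rewrite nth_default// (leq_trans sb).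
Qed.

Lemma quadX_sq : ('qX : B) * 'qX = alpha *: 'qX - beta *: 1.
Proof.
have : in_qpoly quad_poly ('X * 'X - alpha *: 'X + beta *: 1) = 0.
  rewrite alg_polyC -expr2 -/quad_poly.
  apply: val_inj; rewrite /= mk_monic_quad_poly.
  exact: (Pdiv.RingMonic.rmodpp quad_poly_monic).
rewrite linearD linearB /= ![in_qpoly _ (_ *: _)]linearZ /= in_qpolyM in_qpoly1.
by move/eqP; rewrite -addrA addr_eq0 opprD opprK => /eqP.
Qed.

Variable A : algType k.

Definition left_derivation (f delta : A -> A) :=
  forall a b, delta (a * b) = delta a * b + f a * delta b.

Record twisting_pair (f delta : A -> A) : Prop := TwistingPair {
  twisting_pair_deriv : left_derivation f delta;
  twisting_pair_square : forall a,
    delta (delta a) - alpha *: delta a + beta *: a = beta *: f (f a);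
  twisting_pair_mixed : forall a,
    f (delta a) + delta (f a) = alpha *: (f a - f (f a))
}.

(* The first coordinate of A (x) B with respect to the basis (1, x) of B. *)
Definition quad_coord0_pure (a : A) (b : B) : A := (b : {poly k})`_0 *: a.

Lemma quad_coord0_pure_is_bilinear : bilinear_for *:%R *:%R quad_coord0_pure.
Proof.
split=> [b|a] c x y /=; rewrite /quad_coord0_pure.
- by rewrite scalerDr !scalerA mulrC.
- by rewrite !coefE scalerDl scalerA.
Qed.

HB.instance Definition _ := bilinear_isBilinear.Build k A B A
  *:%R *:%R quad_coord0_pure quad_coord0_pure_is_bilinear.

Section Map.
Variables (f : {lrmorphism A -> A}) (delta : {linear A -> A}).

(* The linear extension in b of 1 (x) a |-> a (x) 1 and
   x (x) a |-> delta a (x) 1 + f a (x) x. *)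
Definition quad_twist_pure (b : B) (a : A) : tensor A B :=
  (b : {poly k})`_0 *: (a \ox 1) +
  (b : {poly k})`_1 *: (delta a \ox 1 + f a \ox 'qX).

Lemma quad_twist_pure_is_bilinear :
  bilinear_for *:%R *:%R quad_twist_pure.
Proof.
split=> [a|b] c x y /=; rewrite /quad_twist_pure.
- by rewrite !coefE !scalerDl -!scalerA addrACA -scalerDr.
- rewrite !linearP !linearPl addrACA -scalerDr.
  rewrite ![(b : {poly k})`__ *: (c *: _ + _)]scalerDr addrACA !scalerA.
  by rewrite /= !scalerA ![c * _]mulrC.
Qed.

HB.instance Definition _ := bilinear_isBilinear.Build k B A (tensor A B)
  *:%R *:%R quad_twist_pure quad_twist_pure_is_bilinear.

Definition quad_twist_map : tensor B A -> tensor A B :=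
  tensor_lift quad_twist_pure.

HB.instance Definition _ := GRing.Linear.on quad_twist_map.

Lemma quad_twist_map1 a : quad_twist_map (1 \ox a) = a \ox 1.
Proof.
by rewrite /quad_twist_map tensor_liftE /= /quad_twist_pure /= !coefE /=
  scale1r scale0r addr0.
Qed.

Lemma quad_twist_mapX a :
  quad_twist_map ('qX \ox a) = delta a \ox 1 + f a \ox 'qX.
Proof.
rewrite /quad_twist_map tensor_liftE -[LHS]/(quad_twist_pure 'qX a).
by rewrite /quad_twist_pure quadX_val !coefX scale1r scale0r add0r.
Qed.

Lemma quad_ind (P : B -> Prop) : P 1 -> P 'qX ->
  (forall c x y, P x -> P y -> P (c *: x + y)) -> forall b, P b.
Proof.
move=> P1 PX PL b; rewrite [b]quad_basis; have P0 : P 0.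
  by have := PL (-1) _ _ P1 P1; rewrite scaleN1r addNr.
by apply: (PL) => //; rewrite -[_ *: _]addr0; exact: PL.
Qed.

Hypothesis fdelta : twisting_pair f delta.

Lemma quad_twist_map_twisting : twisting_map quad_twist_map.
Proof.
case: fdelta => fder fsq fmix; split.
- elim/quad_ind=> [a a'|a a'|c b b' IHb IHb' a a'].
  + rewrite !tmapE /= tmulE !quad_twist_map1 tassocE tmapE /= quad_twist_map1.
    by rewrite tassocVE tmapE /= tmulE.
  + rewrite !tmapE /= tmulE !quad_twist_mapX linearDl !linearD /= !tassocE.
    rewrite !tmapE /= quad_twist_map1 quad_twist_mapX linearDr !linearD /=.
    rewrite !tassocVE !tmapE /= !tmulE fder rmorphM linearDl /=.
    by rewrite addrA.
  + by rewrite !linearPl !linearP /= IHb IHb'.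
- move=> b; elim/quad_ind: b => [b'|b'|c x y IHx IHy b' a].
  + move=> a; rewrite !tmapE /= tmulE mul1r.
    elim/tensor_ind: (quad_twist_map _) => [a1 b1|x y IHx IHy].
      by rewrite tassocVE tmapE /= quad_twist_map1 tassocE tmapE /= tmulE mul1r.
    by rewrite [in LHS]IHx [in LHS]IHy linearDr !linearD.
  + elim/quad_ind: b' => [a|a|c x y IHx IHy a].
    * rewrite !tmapE /= tmulE mulr1 !quad_twist_map1 tassocVE tmapE /=.
      rewrite quad_twist_mapX linearDl !linearD /= !tassocE !tmapE /= !tmulE.
      by rewrite !mulr1.
    * rewrite !tmapE /= tmulE quadX_sq linearBl !linearZl_LR linearB !linearZ /=.
      rewrite quad_twist_map1 quad_twist_mapX linearDr !linearD /= !tassocVE.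
      rewrite !tmapE /= !quad_twist_mapX !linearDl !linearD /= !tassocE.
      rewrite !tmapE /= !tmulE !mulr1 mul1r quadX_sq.
      have E1 : delta (delta a) = alpha *: delta a - beta *: a + beta *: f (f a).
        by rewrite -fsq addrC -addrA [beta *: a + _]addrC !subrK.
      have E2 : delta (f a) = alpha *: f a - alpha *: f (f a) - f (delta a).
        by rewrite -scalerBr -fmix addrC addKr.
      rewrite E1 E2 !(linearBl, linearDl, linearBr, linearZl_LR, linearZr_LR) /=.
      rewrite scalerN.
      move: (alpha *: _) (alpha *: (f a \ox _)) (beta *: _) (beta *: _)
        (alpha *: _) (f (delta a) \ox _) => d p q g r m.
      rewrite [p - d - m]addrAC [_ - d + (d - q)]addrA subrK [p - m - q]addrAC.
      by rewrite [RHS]addrACA subrr addr0 [p - q]addrC addrA addrK addrAC.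
    * by rewrite !(linearPl, linearPr, linearP) /= IHx IHy.
  + by rewrite !linearPl !linearP /= IHx IHy.
- exact: quad_twist_map1.
- elim/quad_ind=> [||c x y IHx IHy].
  + exact: quad_twist_map1.
  + rewrite quad_twist_mapX rmorph1.
    suff -> : delta 1 = 0 by rewrite linear0l add0r.
    have /eqP := fder 1 1; rewrite !mul1r rmorph1 mul1r mulr1.
    by rewrite -subr_eq0 opprD addrA subrr sub0r oppr_eq0 => /eqP.
  + by rewrite linearPl linearP /= IHx IHy linearPr.
Qed.

Definition quad_twisting : twisting A B := Twisting quad_twist_map_twisting.

Definition quad_twisted_tensor := twisted_tensor quad_twisting.

Local Notation T := quad_twisted_tensor.

HB.instance Definition _ := GRing.Lmodule.on T.
HB.instance Definition _ := GRing.PzRing.on T.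

Lemma quad_twisted_nontrivial : (1 : T) != 0.
Proof.
apply/eqP => /(congr1 (tensor_lift quad_coord0_pure)).
rewrite linear0 tensor_liftE /= /quad_coord0_pure coefE /= scale1r.
by apply/eqP; exact: oner_neq0.
Qed.

HB.instance Definition _ :=
  GRing.PzSemiRing_isNonZero.Build T quad_twisted_nontrivial.

Lemma quad_twisted_scaleAl c (x y : T) : c *: (x * y) = (c *: x) * y.
Proof. by apply/esym; exact: (linearZl_LR (@twisted_mul k A B quad_twisting)). Qed.

Lemma quad_twisted_scaleAr c (x y : T) : c *: (x * y) = x * (c *: y).
Proof. by apply/esym; exact: (linearZr_LR (@twisted_mul k A B quad_twisting)). Qed.

HB.instance Definition _ :=
  GRing.Lmodule_isLalgebra.Build k T quad_twisted_scaleAl.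
HB.instance Definition _ :=
  GRing.Lalgebra_isAlgebra.Build k T quad_twisted_scaleAr.

End Map.
End QuadraticTwist.

(* Main.v *)
Require Import Defs.
From HB Require Import structures.
From mathcomp Require Import all_boot all_algebra.

Import GRing.Theory.
Local Open Scope ring_scope.

(** Since [twist] sits in the middle of the product, [phi (x) B] is
    multiplicative exactly when it commutes with the twisting map, in the sense
    that [tau (b (x) phi a) = (phi (x) B) (tau (b (x) a))]: the product of
    [1 (x) b] and [a (x) 1] is [tau (b (x) a)] itself, and conversely every
    product of pure tensors is obtained from such a value by multiplying by [A]
    on the left and by [B] on the right, which [phi (x) B] respects
    ([tmap_mul_iff_twist]).

    For the quadratic algebra, both sides of that condition are linear in [b],
    so it only has to be tested on the basis [1], ['qX].  It is automatic at
    [1]; at ['qX] it reads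
    [delta (phi a) (x) 1 + f (phi a) (x) 'qX
       = phi (delta a) (x) 1 + phi (f a) (x) 'qX],
    and the two coordinates can be compared separately because [1] and ['qX]
    are linearly independent ([quad_tensor_inj]). *)

Section TwistedLift.
Variables (k : fieldType) (A B : algType k) (tau : twisting A B).
Variable phi : {lrmorphism A -> A}.

Lemma tmap_tact (a : A) (b : B) (x : tensor A B) :
  tmap phi idfun (tact a b x) = tact (phi a) b (tmap phi idfun x).
Proof.
elim/tensor_ind: x => [a' b'|x y IHx IHy]; last by rewrite !linearD /= IHx IHy.
by rewrite tactE !tmapE /= tactE rmorphM.
Qed.

(** Since [tau (b (x) a)] is the product of [1 (x) b] and [a (x) 1], a
    multiplicative lift has to commute with [tau]; conversely, the product of
    [a (x) b] and [a' (x) b'] is [tact a b' (tau (b (x) a'))], so the lift is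
    controlled by its effect on [tau] and by [tmap_tact]. *)
Lemma tmap_mul_iff_twist :
  {morph tmap phi idfun : x y / @twisted_mul k A B tau x y} <->
  forall (b : B) (a : A), tau (b \ox phi a) = tmap phi idfun (tau (b \ox a)).
Proof.
split=> [phiM b a|phi_tau x y].
- have mulE c : @twisted_mul k A B tau (1 \ox b) (c \ox 1) = tau (b \ox c).
    rewrite twisted_mulE.
    elim/tensor_ind: (tau _) => [a' b'|x y IHx IHy].
      by rewrite tactE mul1r mulr1.
    by rewrite linearD /= IHx IHy.
  by rewrite -!mulE phiM !tmapE /= rmorph1.
- elim/tensor_ind: x => [a b|x x' IHx IHx'];
    last by rewrite linearDl !linearD /= IHx IHx' linearDl.
  elim/tensor_ind: y => [a' b'|y y' IHy IHy'];
    last by rewrite linearDr !linearD /= IHy IHy' linearDr.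
  by rewrite twisted_mulE !tmapE /= twisted_mulE phi_tau tmap_tact.
Qed.

End TwistedLift.

Section QuadraticLift.
Variables (k : fieldType) (A : algType k) (alpha beta : k).
Local Notation B := {poly %/ quad_poly alpha beta}.

(** The companion of [quad_coord0_pure] for the basis vector ['qX] of [B]. *)
Definition quad_coord1_pure (a : A) (b : B) : A := (b : {poly k})`_1 *: a.

Lemma quad_coord1_pure_is_bilinear : bilinear_for *:%R *:%R quad_coord1_pure.
Proof.
split=> [b|a] c x y /=; rewrite /quad_coord1_pure.
- by rewrite scalerDr !scalerA mulrC.
- by rewrite !coefE scalerDl scalerA.
Qed.

HB.instance Definition _ := bilinear_isBilinear.Build k A B A
  *:%R *:%R quad_coord1_pure quad_coord1_pure_is_bilinear.

(** The family [1], ['qX] stays independent over [A] in [A (x) B]: the two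
    coordinate functionals of [B] extend [A]-linearly and read off [a0] and
    [a1]. *)
Lemma quad_tensor_inj (a0 a1 c0 c1 : A) :
  a0 \ox (1 : B) + a1 \ox ('qX : B) = c0 \ox 1 + c1 \ox 'qX ->
  a0 = c0 /\ a1 = c1.
Proof.
move=> eq_ac; split.
- move/(congr1 (tensor_lift (@quad_coord0_pure k alpha beta A))): eq_ac.
  rewrite !linearD /= !tensor_liftE /= /quad_coord0_pure quadX_val.
  by rewrite !coefE /= !scale1r !scale0r !addr0.
- move/(congr1 (tensor_lift quad_coord1_pure)): eq_ac.
  rewrite !linearD /= !tensor_liftE /= /quad_coord1_pure quadX_val.
  by rewrite !coefE /= !scale1r !scale0r !add0r.
Qed.

Variables (f : {lrmorphism A -> A}) (delta : {linear A -> A}).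
Variable phi : {lrmorphism A -> A}.

(** Naturality is trivial at [b = 1], and at [b = 'qX] its two coordinates are
    the two commutation relations; linearity in [b] covers the rest. *)
Lemma quad_twist_natural_iff :
  (forall (b : B) (a : A), quad_twist_map f delta (b \ox phi a) =
     tmap phi idfun (quad_twist_map f delta (b \ox a))) <->
  (f \o phi =1 phi \o f /\ delta \o phi =1 phi \o delta).
Proof.
split=> [phi_tau|[f_phi delta_phi]].
- have eqX a : delta (phi a) = phi (delta a) /\ f (phi a) = phi (f a).
    have := phi_tau 'qX a; rewrite !quad_twist_mapX linearD /= !tmapE.
    exact: quad_tensor_inj.
  by split=> a /=; have [] := eqX a.
- elim/quad_ind=> [a|a|c x y IHx IHy a].
  + by rewrite !quad_twist_map1 tmapE.
  + rewrite !quad_twist_mapX linearD /= !tmapE.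
    by have /= -> := delta_phi a; have /= -> := f_phi a.
  + by rewrite !linearPl !linearP /= IHx IHy.
Qed.

End QuadraticLift.

Theorem theorem1p7 (k : fieldType) (A : algType k) (alpha beta : k)
    (f : {lrmorphism A -> A}) (delta : {linear A -> A})
    (fdelta : twisting_pair alpha beta f delta)
    (phi : {lrmorphism A -> A}) :
  (exists Phi : {lrmorphism quad_twisted_tensor fdelta ->
                            quad_twisted_tensor fdelta},
     forall (a : A) (b : {poly %/ quad_poly alpha beta}),
       Phi (a \ox b) = phi a \ox b) <->
  (f \o phi =1 phi \o f /\ delta \o phi =1 phi \o delta).
Proof.
have mul_iff := tmap_mul_iff_twist _ _ _ (quad_twisting fdelta) phi.
split=> [[Phi PhiE]|/quad_twist_natural_iff/mul_iff phiM].
- apply/quad_twist_natural_iff/mul_iff.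
  have PhiE' : Phi =1 tmap phi idfun.
    elim/tensor_ind=> [a b|x y IHx IHy]; first by rewrite PhiE tmapE.
    by rewrite (linearD Phi) linearD /= IHx IHy.
  by move=> x y; rewrite -!PhiE'; exact: (rmorphM Phi).
- pose T := quad_twisted_tensor fdelta.
  pose Phi : T -> T := tmap phi idfun.
  have Phi_linear : linear Phi by exact: linearP.
  have Phi_monoid : monoid_morphism Phi.
    by split; [rewrite /Phi [LHS]tmapE /= rmorph1 | exact: phiM].
  pose lin := GRing.isLinear.Build k T T *:%R Phi Phi_linear.
  pose mon := GRing.isMonoidMorphism.Build T T Phi Phi_monoid.
  pose PhiM : {lrmorphism T -> T} := HB.pack Phi lin mon.
  by exists PhiM => a b; exact: tmapE.
Qed.
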